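(* Let $\mathcal L$ be a 2-z-exact 2-category and let $A\xrightarrow{f}B\xrightarrow{g}C$ be a pair of composable normal 1-cells with $g\circ f\cong0$. Then $(f,g)$ is exact in $B$ if and only if the dinversion $$w=\operatorname{coker}(f)\circ\ker(g)\colon\mathrm{Ker}(g)\to\mathrm{Cok}(f)$$ of the antinormal decomposition $(\mathrm{im}(f),\mathrm{coim}(g))$ of the zero map is null (that is, $w\cong0$).
   Context: 2-categories are strict. For 1-cells, $\cong$ means that there is an invertible 2-cell between them. A bizero object of a 2-category $\mathcal L$ is an object $0$ such that for every object $A$ the hom-categories $\mathcal L(A,0)$ and $\mathcal L(0,A)$ are equivalent to the terminal category. A 1-cell is null if it factors through $0$; $f\cong 0$ means that $f$ is isomorphic to a null 1-cell. The bizero object is strong if between any two parallel 1-cells that factor through $0$ there is exactly one 2-cell. In a 2-category with a strong bizero object, a 2-kernel of $f\colon A\to B$ is a 1-cell $k\colon K\to A$ with an invertible 2-cell $f\circ k\cong 0$ such that (1) for every $z\colon Z\to A$ with $f\circ z\cong0$ there is $u\colon Z\to K$ with $k\circ u\cong z$; (2) for all $u,v\colon Z\to K$ and every 2-cell $\lambda\colon k\circ u\Rightarrow k\circ v$ there is a unique 2-cell $\mu\colon u\Rightarrow v$ whose whiskering with $k$ is $\lambda$. 2-cokernels are defined dually. They are unique up to equivalence and written $\ker(f)\colon\mathrm{Ker}(f)\to A$, $\operatorname{coker}(f)\colon B\to\mathrm{Cok}(f)$. A 2-z-exact 2-category is a 2-category with a strong bizero object having all 2-kernels and all 2-cokernels.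 A normal 2-monomorphism is a 1-cell which is a 2-kernel of some 1-cell; a normal 2-epimorphism is a 1-cell which is a 2-cokernel of some 1-cell. A 1-cell $f$ is normal if $f\cong m\circ e$ with $e$ a normal 2-epimorphism and $m$ a normal 2-monomorphism; this factorisation is unique up to equivalence and one writes $m=\mathrm{im}(f)$, $e=\mathrm{coim}(f)$. The pair $(f,g)$ of normal 1-cells is exact in $B$ if the following equivalent conditions hold: $\mathrm{im}(f)$ is a 2-kernel of $g$; $\mathrm{coim}(g)$ is a 2-cokernel of $f$; $\mathrm{im}(f)$ is a 2-kernel of $\mathrm{coim}(g)$ and $\mathrm{coim}(g)$ is a 2-cokernel of $\mathrm{im}(f)$. The dinversion of a pair $(m,e)$, with $m$ a normal 2-monomorphism and $e$ a composable normal 2-epimorphism, is $\operatorname{coker}(m)\circ\ker(e)$; the pair is an antinormal decomposition of the zero map if $e\circ m\cong 0$. One has $\operatorname{coker}(\mathrm{im}(f))\simeq\operatorname{coker}(f)$ and $\ker(\mathrm{coim}(g))\simeq\ker(g)$. *)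

(* Defs.v *)
Set Implicit Arguments.
Unset Strict Implicit.
Unset Printing Implicit Defensive.

Declare Scope two_cat_scope.
Delimit Scope two_cat_scope with two_cat.

Record category := {
  obj :> Type;
  arr : obj -> obj -> Type;
  idm : forall X, arr X X;
  cmp : forall X Y Z, arr Y Z -> arr X Y -> arr X Z;
  cmp_idl : forall X Y (a : arr X Y), cmp (idm Y) a = a;
  cmp_idr : forall X Y (a : arr X Y), cmp a (idm X) = a;
  cmpA : forall X Y Z W (c : arr Z W) (b : arr Y Z) (a : arr X Y),
    cmp c (cmp b a) = cmp (cmp c b) a
}.

Arguments arr {C} X Y : rename.
Arguments idm {C} X : rename.
Arguments cmp {C X Y Z} b a : rename.

Definition invertible {C : category} {X Y : C} (a : arr X Y) : Prop :=
  exists b : arr Y X, cmp b a = idm X /\ cmp a b = idm Y.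

Definition isomorphic {C : category} (X Y : C) : Prop :=
  exists a : arr X Y, invertible a.

(** The identity of [X], seen as an arrow [X -> Y] along [X = Y]. *)
Definition eq_arr {C : category} {X Y : C} (e : X = Y) : arr X Y :=
  match e in _ = Y0 return arr X Y0 with eq_refl => idm X end.

Record functor (C D : category) := {
  fobj :> C -> D;
  fmap : forall X Y, arr X Y -> arr (fobj X) (fobj Y);
  fmap_id : forall X, fmap (idm X) = idm (fobj X);
  fmap_cmp : forall X Y Z (b : arr Y Z) (a : arr X Y),
    fmap (cmp b a) = cmp (fmap b) (fmap a)
}.

Definition functor_id (C : category) : functor C C :=
  {| fobj := fun X => X;
     fmap := fun _ _ a => a;
     fmap_id := fun _ => eq_refl;
     fmap_cmp := fun _ _ _ _ _ => eq_refl |}.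

Definition functor_comp (C D E : category) (G : functor D E) (F : functor C D) :
    functor C E :=
  {| fobj := fun X => G (F X);
     fmap := fun _ _ a => fmap G (fmap F a);
     fmap_id := fun X => eq_trans (f_equal (fmap G (Y := F X)) (fmap_id F X))
                                  (fmap_id G (F X));
     fmap_cmp := fun _ _ _ b a =>
       eq_trans (f_equal (fmap G (Y := _)) (fmap_cmp F b a))
                (fmap_cmp G (fmap F b) (fmap F a)) |}.

Definition natural_iso (C D : category) (F G : functor C D) : Prop :=
  exists t : forall X, arr (F X) (G X),
    (forall X Y (a : arr X Y), cmp (t Y) (fmap F a) = cmp (fmap G a) (t X)) /\
    (forall X, invertible (t X)).

Definition equivalent_categories (C D : category) : Prop :=
  exists (F : functor C D) (G : functor D C),
    natural_iso (functor_comp G F) (functor_id C) /\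
    natural_iso (functor_comp F G) (functor_id D).

Definition terminal_category : category :=
  {| obj := unit;
     arr := fun _ _ => unit;
     idm := fun _ => tt;
     cmp := fun _ _ _ _ _ => tt;
     cmp_idl := fun _ _ a => match a with tt => eq_refl end;
     cmp_idr := fun _ _ a => match a with tt => eq_refl end;
     cmpA := fun _ _ _ _ _ _ _ => eq_refl |}.

(** [hom A B] is the hom-category: its objects are the 1-cells, its arrows the
    2-cells, its composition the vertical one.  Composition of 1-cells is
    associative and unital up to [=]; the corresponding laws for [hcomp] relate
    2-cells whose boundaries are only propositionally equal, so the two sides
    are compared through the identity 2-cells [eq_arr]. *)
Record two_category := {
  cell0 :> Type;
  hom : cell0 -> cell0 -> category;
  id1 : forall A, hom A A;
  comp1 : forall A B C, hom B C -> hom A B -> hom A C;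
  hcomp : forall A B C (g g' : hom B C) (f f' : hom A B),
    arr g g' -> arr f f' -> arr (comp1 g f) (comp1 g' f');
  hcomp_id : forall A B C (g : hom B C) (f : hom A B),
    hcomp (idm g) (idm f) = idm (comp1 g f);
  hcomp_cmp : forall A B C (g g' g'' : hom B C) (f f' f'' : hom A B)
      (b' : arr g' g'') (b : arr g g') (a' : arr f' f'') (a : arr f f'),
    hcomp (cmp b' b) (cmp a' a) = cmp (hcomp b' a') (hcomp b a);
  comp1_idl : forall A B (f : hom A B), comp1 (id1 B) f = f;
  comp1_idr : forall A B (f : hom A B), comp1 f (id1 A) = f;
  comp1A : forall A B C D (h : hom C D) (g : hom B C) (f : hom A B),
    comp1 h (comp1 g f) = comp1 (comp1 h g) f;
  hcomp_idl : forall A B (f f' : hom A B) (a : arr f f'),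
    cmp (eq_arr (comp1_idl f')) (hcomp (idm (id1 B)) a)
    = cmp a (eq_arr (comp1_idl f));
  hcomp_idr : forall A B (f f' : hom A B) (a : arr f f'),
    cmp (eq_arr (comp1_idr f')) (hcomp a (idm (id1 A)))
    = cmp a (eq_arr (comp1_idr f));
  hcompA : forall A B C D (h h' : hom C D) (g g' : hom B C) (f f' : hom A B)
      (c : arr h h') (b : arr g g') (a : arr f f'),
    cmp (eq_arr (comp1A h' g' f')) (hcomp c (hcomp b a))
    = cmp (hcomp (hcomp c b) a) (eq_arr (comp1A h g f))
}.

Arguments hom {t} A B : rename.
Arguments id1 {t} A : rename.
Arguments comp1 {t A B C} g f : rename.
Arguments hcomp {t A B C g g' f f'} b a : rename.

Notation "g ∘ f" := (comp1 g f) (at level 40, left associativity) : two_cat_scope.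
Notation "f ⇒ g" := (arr f g) (at level 70, no associativity) : two_cat_scope.
Notation "f ≅ g" := (isomorphic f g) (at level 70, no associativity) : two_cat_scope.
Local Open Scope two_cat_scope.

Definition lwhisker {L : two_category} {A B C : L} (k : hom B C) {u v : hom A B}
    (mu : u ⇒ v) : k ∘ u ⇒ k ∘ v := hcomp (idm k) mu.

Definition rwhisker {L : two_category} {A B C : L} {u v : hom B C} (mu : u ⇒ v)
    (k : hom A B) : u ∘ k ⇒ v ∘ k := hcomp mu (idm k).

Section Zero.

Variables (L : two_category) (O : L).

Definition bizero : Prop :=
  forall A : L, equivalent_categories (hom A O) terminal_category /\
                equivalent_categories (hom O A) terminal_category.

Definition null {A B : L} (f : hom A B) : Prop :=
  exists (u : hom A O) (v : hom O B), f = v ∘ u.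

(** The relation written [f ≅ 0]. *)
Definition iso_null {A B : L} (f : hom A B) : Prop :=
  exists z : hom A B, null z /\ f ≅ z.

Definition strong_bizero : Prop :=
  bizero /\
  forall (A B : L) (f g : hom A B), null f -> null g ->
    exists a : f ⇒ g, forall b : f ⇒ g, a = b.

Definition is_two_kernel {A B K : L} (f : hom A B) (k : hom K A) : Prop :=
  iso_null (f ∘ k) /\
  (forall (Z : L) (z : hom Z A), iso_null (f ∘ z) ->
     exists u : hom Z K, k ∘ u ≅ z) /\
  (forall (Z : L) (u v : hom Z K) (l : k ∘ u ⇒ k ∘ v),
     exists! mu : u ⇒ v, lwhisker k mu = l).

Definition is_two_cokernel {A B Q : L} (f : hom A B) (q : hom B Q) : Prop :=
  iso_null (q ∘ f) /\
  (forall (Z : L) (z : hom B Z), iso_null (z ∘ f) ->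
     exists u : hom Q Z, u ∘ q ≅ z) /\
  (forall (Z : L) (u v : hom Q Z) (l : u ∘ q ⇒ v ∘ q),
     exists! mu : u ⇒ v, rwhisker mu q = l).

Definition two_z_exact : Prop :=
  strong_bizero /\
  (forall (A B : L) (f : hom A B), exists (K : L) (k : hom K A), is_two_kernel f k) /\
  (forall (A B : L) (f : hom A B), exists (Q : L) (q : hom B Q), is_two_cokernel f q).

Definition normal_two_mono {I B : L} (m : hom I B) : Prop :=
  exists (C : L) (h : hom B C), is_two_kernel h m.

Definition normal_two_epi {A I : L} (e : hom A I) : Prop :=
  exists (C : L) (h : hom C A), is_two_cokernel h e.

(** [m] is an image and [e] a coimage of [f]. *)
Definition normal_factorisation {A B I : L} (f : hom A B) (e : hom A I)
    (m : hom I B) : Prop :=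
  normal_two_epi e /\ normal_two_mono m /\ f ≅ m ∘ e.

Definition normal {A B : L} (f : hom A B) : Prop :=
  exists (I : L) (e : hom A I) (m : hom I B), normal_factorisation f e m.

(** The image of [f] is a 2-kernel of [g].  Images exist because [f] is normal;
    the condition is required of each of them, which makes no difference since
    they are unique up to equivalence. *)
Definition exact {A B C : L} (f : hom A B) (g : hom B C) : Prop :=
  normal f /\ normal g /\
  forall (I : L) (e : hom A I) (m : hom I B),
    normal_factorisation f e m -> is_two_kernel g m.

Definition antinormal_decomposition_of_zero {I B J : L} (m : hom I B)
    (e : hom B J) : Prop :=
  normal_two_mono m /\ normal_two_epi e /\ iso_null (e ∘ m).

Definition is_dinversion {I B J K Q : L} (m : hom I B) (e : hom B J)
    (w : hom K Q) : Prop :=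
  exists (q : hom B Q) (k : hom K B),
    is_two_cokernel m q /\ is_two_kernel e k /\ w = q ∘ k.

End Zero.

(* Main.v *)
Require Import Defs.
From Stdlib Require Import Setoid Morphisms.
Local Open Scope two_cat_scope.

Set Implicit Arguments.
Unset Strict Implicit.

(** Postcomposition with a 2-kernel [m] is fully faithful, so [m ∘ x ≅ 0]
    forces [x ≅ 0]: a null 1-cell isomorphic to [m ∘ x] has its second factor,
    a 1-cell out of [O], lifted through [m], and the resulting isomorphism
    between two 1-cells of the form [m ∘ _] is then reflected
    ([normal_mono_reflects_null]); dually for 2-cokernels
    ([normal_epi_reflects_null]).  Cancelling the image of [g] and the coimage
    of [f] in [g ∘ f ≅ 0] gives [coim g ∘ im f ≅ 0], and the same cancellations
    show that [f] and [im f] have the same 2-cokernels ([cokernel_of_image]),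
    and [g] and [coim g] the same 2-kernels ([kernel_of_coimage]).

    If [im f] is a 2-kernel of [g], then [ker g ≅ im f ∘ u] for some [u], and
    [coker f ∘ ker g ≅ coker f ∘ im f ∘ u ≅ 0].  Conversely, [im f], being a
    normal 2-monomorphism, is a 2-kernel of its 2-cokernel [coker f]
    ([normal_mono_kernel_of_cokernel]).  If [coker f ∘ ker g ≅ 0], any [z] with
    [g ∘ z ≅ 0] factors through [ker g], so is killed by [coker f], so factors
    through [im f]; hence [im f] is a 2-kernel of [g]. *)

#[local] Instance isomorphic_equivalence (C : category) :
  Equivalence (@isomorphic C).
Proof.
  split.
  - intros X; exists (idm X), (idm X); split; apply cmp_idl.
  - intros X Y [a [b [ba ab]]]; exists b, a; split; assumption.
  - intros X Y Z [a [a' [a'a aa']]] [b [b' [b'b bb']]].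
    exists (cmp b a), (cmp a' b'); split.
    + now rewrite <- cmpA, (cmpA b'), b'b, cmp_idl.
    + now rewrite <- cmpA, (cmpA a), aa', cmp_idl.
Qed.

#[local] Instance comp1_isomorphic (L : two_category) (A B C : L) :
  Proper (@isomorphic (hom B C) ==> @isomorphic (hom A B) ==>
          @isomorphic (hom A C)) (@comp1 L A B C).
Proof.
  intros g g' [b [b' [b'b bb']]] f f' [a [a' [a'a aa']]].
  exists (hcomp b a), (hcomp b' a'); split.
  - now rewrite <- hcomp_cmp, b'b, a'a, hcomp_id.
  - now rewrite <- hcomp_cmp, bb', aa', hcomp_id.
Qed.

(** Postcomposition with [k] is bijective on 2-cells: the clause on 2-cells in
    the definition of a 2-kernel, which depends on [k] alone. *)
Definition fully_faithful {L : two_category} {A K : L} (k : hom K A) : Prop :=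
  forall (Z : L) (u v : hom Z K) (l : k ∘ u ⇒ k ∘ v),
    exists! mu : u ⇒ v, lwhisker k mu = l.

(** Precomposition with [q] is bijective on 2-cells. *)
Definition co_fully_faithful {L : two_category} {B Q : L} (q : hom B Q) : Prop :=
  forall (Z : L) (u v : hom Q Z) (l : u ∘ q ⇒ v ∘ q),
    exists! mu : u ⇒ v, rwhisker mu q = l.

Lemma lwhisker_cmp (L : two_category) (A B C : L) (k : hom B C)
    (u v w : hom A B) (b : v ⇒ w) (a : u ⇒ v) :
  lwhisker k (cmp b a) = cmp (lwhisker k b) (lwhisker k a).
Proof.
  unfold lwhisker; now rewrite <- hcomp_cmp, cmp_idl.
Qed.

Lemma rwhisker_cmp (L : two_category) (A B C : L) (k : hom A B)
    (u v w : hom B C) (b : v ⇒ w) (a : u ⇒ v) :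
  rwhisker (cmp b a) k = cmp (rwhisker b k) (rwhisker a k).
Proof.
  unfold rwhisker; now rewrite <- hcomp_cmp, cmp_idl.
Qed.

Lemma fully_faithful_reflects_iso (L : two_category) (A K Z : L) (k : hom K A)
    (u v : hom Z K) :
  fully_faithful k -> k ∘ u ≅ k ∘ v -> u ≅ v.
Proof.
  intros Hk [l [l' [l'l ll']]].
  assert (faithful : forall (w w' : hom Z K) (a b : w ⇒ w'),
             lwhisker k a = lwhisker k b -> a = b).
  { intros w w' a b ab.
    destruct (Hk _ _ _ (lwhisker k b)) as [c [_ Hc]].
    now rewrite <- (Hc a ab), <- (Hc b eq_refl). }
  destruct (Hk _ _ _ l) as [a [Ha _]], (Hk _ _ _ l') as [b [Hb _]].
  exists a, b; split; apply faithful; rewrite lwhisker_cmp, Ha, Hb;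
    unfold lwhisker; now rewrite hcomp_id.
Qed.

Lemma co_fully_faithful_reflects_iso (L : two_category) (B Q Z : L)
    (q : hom B Q) (u v : hom Q Z) :
  co_fully_faithful q -> u ∘ q ≅ v ∘ q -> u ≅ v.
Proof.
  intros Hq [l [l' [l'l ll']]].
  assert (faithful : forall (w w' : hom Q Z) (a b : w ⇒ w'),
             rwhisker a q = rwhisker b q -> a = b).
  { intros w w' a b ab.
    destruct (Hq _ _ _ (rwhisker b q)) as [c [_ Hc]].
    now rewrite <- (Hc a ab), <- (Hc b eq_refl). }
  destruct (Hq _ _ _ l) as [a [Ha _]], (Hq _ _ _ l') as [b [Hb _]].
  exists a, b; split; apply faithful; rewrite rwhisker_cmp, Ha, Hb;
    unfold rwhisker; now rewrite hcomp_id.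
Qed.

Section Null.

Variables (L : two_category) (O : L).

#[local] Instance iso_null_isomorphic (A B : L) :
  Proper (@isomorphic (hom A B) ==> iff) (@iso_null L O A B).
Proof.
  intros f f' ff'; split; intros [z [z0 fz]]; exists z; split; auto.
  - now rewrite <- ff'.
  - now rewrite ff'.
Qed.

Lemma iso_null_from (A B : L) (v : hom O B) (u : hom A O) : iso_null O (v ∘ u).
Proof.
  exists (v ∘ u); split; [now exists u, v | reflexivity].
Qed.

Lemma iso_null_compl (A B C : L) (g : hom B C) (f : hom A B) :
  iso_null O f -> iso_null O (g ∘ f).
Proof.
  intros [z [[u [v ->]] fz]]; rewrite fz, comp1A; apply iso_null_from.
Qed.

Lemma iso_null_compr (A B C : L) (g : hom B C) (f : hom A B) :
  iso_null O g -> iso_null O (g ∘ f).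
Proof.
  intros [z [[u [v ->]] gz]]; rewrite gz, <- comp1A; apply iso_null_from.
Qed.

Lemma normal_mono_reflects_null (Z I B : L) (m : hom I B) (x : hom Z I) :
  normal_two_mono O m -> iso_null O (m ∘ x) -> iso_null O x.
Proof.
  intros [D [h [_ [lift ff]]]] [z [[u [v ->]] mx]].
  (* [h ∘ v] is null because its domain is [O]. *)
  destruct (lift O v) as [t tv].
  { rewrite <- (comp1_idr (h ∘ v)); apply iso_null_from. }
  assert (xtu : x ≅ t ∘ u).
  { apply (fully_faithful_reflects_iso ff); now rewrite mx, comp1A, tv. }
  rewrite xtu; apply iso_null_from.
Qed.

Lemma normal_epi_reflects_null (A I Z : L) (e : hom A I) (x : hom I Z) :
  normal_two_epi O e -> iso_null O (x ∘ e) -> iso_null O x.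
Proof.
  intros [D [h [_ [lift ff]]]] [z [[u [v ->]] xe]].
  destruct (lift O u) as [t tu].
  { rewrite <- (comp1_idl (u ∘ h)); apply iso_null_from. }
  assert (xvt : x ≅ v ∘ t).
  { apply (co_fully_faithful_reflects_iso ff); now rewrite xe, <- comp1A, tu. }
  rewrite xvt; apply iso_null_from.
Qed.

Lemma iso_null_image (A B I Z : L) (f : hom A B) (e : hom A I) (m : hom I B)
    (z : hom B Z) :
  normal_factorisation O f e m -> iso_null O (z ∘ f) <-> iso_null O (z ∘ m).
Proof.
  intros [He [_ fme]]; rewrite fme, comp1A; split.
  - now apply normal_epi_reflects_null.
  - apply iso_null_compr.
Qed.

Lemma iso_null_coimage (B C J Z : L) (g : hom B C) (e : hom B J) (m : hom J C)
    (z : hom Z B) :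
  normal_factorisation O g e m -> iso_null O (g ∘ z) <-> iso_null O (e ∘ z).
Proof.
  intros [_ [Hm gme]]; rewrite gme, <- comp1A; split.
  - now apply normal_mono_reflects_null.
  - apply iso_null_compl.
Qed.

Lemma cokernel_of_image (A B I Q : L) (f : hom A B) (e : hom A I) (m : hom I B)
    (q : hom B Q) :
  normal_factorisation O f e m -> is_two_cokernel O f q -> is_two_cokernel O m q.
Proof.
  intros Hf [qf [lift ff]]; split; [|split; [|exact ff]].
  - now apply (iso_null_image q Hf).
  - intros Z z zm; apply lift; now apply (iso_null_image z Hf).
Qed.

Lemma kernel_of_coimage (B C J K : L) (g : hom B C) (e : hom B J) (m : hom J C)
    (k : hom K B) :
  normal_factorisation O g e m -> is_two_kernel O g k -> is_two_kernel O e k.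
Proof.
  intros Hg [gk [lift ff]]; split; [|split; [|exact ff]].
  - now apply (iso_null_coimage k Hg).
  - intros Z z ez; apply lift; now apply (iso_null_coimage z Hg).
Qed.

Lemma normal_mono_kernel_of_cokernel (I B Q : L) (m : hom I B) (q : hom B Q) :
  normal_two_mono O m -> is_two_cokernel O m q -> is_two_kernel O q m.
Proof.
  intros [D [h [hm [lift ff]]]] [qm [colift _]].
  split; [exact qm | split; [|exact ff]].
  intros Z z qz; apply lift.
  destruct (colift D h hm) as [t th].
  rewrite <- th, <- comp1A; now apply iso_null_compl.
Qed.

(** A 2-kernel of [q] which is killed by [g] is a 2-kernel of [g] as soon as
    [q] kills [ker g]. *)
Lemma kernel_transfer (I B C K Q : L) (m : hom I B) (g : hom B C) (k : hom K B)
    (q : hom B Q) :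
  is_two_kernel O q m -> is_two_kernel O g k ->
  iso_null O (g ∘ m) -> iso_null O (q ∘ k) -> is_two_kernel O g m.
Proof.
  intros [_ [lift ff]] [_ [liftk _]] gm qk.
  split; [exact gm | split; [|exact ff]].
  intros Z z gz; apply lift.
  destruct (liftk Z z gz) as [u ku].
  rewrite <- ku, comp1A; now apply iso_null_compr.
Qed.

Lemma kernels_dinversion_null (I B C K Q : L) (m : hom I B) (g : hom B C)
    (k : hom K B) (q : hom B Q) :
  is_two_kernel O g m -> is_two_kernel O g k -> iso_null O (q ∘ m) ->
  iso_null O (q ∘ k).
Proof.
  intros [_ [lift _]] [gk _] qm.
  destruct (lift K k gk) as [u mu].
  rewrite <- mu, comp1A; now apply iso_null_compr.
Qed.

End Null.

Theorem corollary4p9 (L : two_category) (O : L) (HL : two_z_exact O)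
    (A B C : L) (f : hom A B) (g : hom B C)
    (f_normal : normal O f) (g_normal : normal O g) (gf0 : iso_null O (g ∘ f))
    (I : L) (coim_f : hom A I) (im_f : hom I B)
    (Hf : normal_factorisation O f coim_f im_f)
    (J : L) (coim_g : hom B J) (im_g : hom J C)
    (Hg : normal_factorisation O g coim_g im_g)
    (Ker_g : L) (ker_g : hom Ker_g B) (Hker : is_two_kernel O g ker_g)
    (Cok_f : L) (coker_f : hom B Cok_f) (Hcoker : is_two_cokernel O f coker_f) :
  antinormal_decomposition_of_zero O im_f coim_g /\
  is_dinversion O im_f coim_g (coker_f ∘ ker_g) /\
  (exact O f g <-> iso_null O (coker_f ∘ ker_g)).
Proof.
  pose proof (cokernel_of_image Hf Hcoker) as Hcok.
  split; [|split; [|split]].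
  - split; [apply Hf | split; [apply Hg|]].
    now apply (iso_null_coimage im_f Hg), (iso_null_image g Hf).
  - exists coker_f, ker_g; split; [exact Hcok | split; [|reflexivity]].
    exact (kernel_of_coimage Hg Hker).
  - intros [_ [_ Hex]].
    exact (kernels_dinversion_null (Hex _ _ _ Hf) Hker (proj1 Hcok)).
  - intros w0; split; [exact f_normal | split; [exact g_normal|]].
    intros I' e m Hem; apply (@kernel_transfer L O _ _ _ _ _ m g ker_g coker_f).
    + exact (normal_mono_kernel_of_cokernel (proj1 (proj2 Hem))
               (cokernel_of_image Hem Hcoker)).
    + exact Hker.
    + now apply (iso_null_image g Hem).
    + exact w0.
Qed.
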